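(* If $(H_{10},\Lambda)$ is a signified graph on $10$ vertices such that every signified graph whose underlying graph is planar admits a signed homomorphism to $(H_{10},\Lambda)$, then $(H_{10},\Lambda)$ is, up to resigning a subset of its vertices, isomorphic (by a sign-preserving isomorphism) to $SP_9^+$.
   Context: A signified graph $(G,\Sigma)$ is a graph $G$ with a set $\Sigma\subseteq E(G)$ of negative edges, other edges positive. Resigning $X\subseteq V(G)$ changes the sign of exactly the edges with one endpoint in $X$; two signified graphs on $G$ are equivalent if one is obtained from the other by resigning. A signified homomorphism is a vertex map sending each edge to an edge of the same sign; a signed homomorphism of $(G,\Sigma)$ to $(H,\Lambda)$ is a signified homomorphism between some signified graphs equivalent to $(G,\Sigma)$ and $(H,\Lambda)$. $SP_9$ is the complete graph on $\mathbb{F}_9$ where $xy$ is negative iff $y-x$ is a non-square in $\mathbb{F}_9$, and $SP_9^+$ is $SP_9$ plus a new vertex joined by positive edges to all nine vertices. *)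

(* Defs.v *)
From HB Require Import structures.
From mathcomp Require Import all_boot all_order all_algebra.
Set Implicit Arguments. Unset Strict Implicit. Unset Printing Implicit Defensive.
Import GRing.Theory.

(* A simple graph on a finite vertex type V: a symmetric irreflexive relation
   [adj].  A signified graph additionally carries a symmetric relation [neg]
   whose value on an edge xy says that xy is negative (its value on non-edges
   is irrelevant). *)

Definition resign (T : finType) (neg : rel T) (X : {set T}) : rel T :=
  fun x y => addb (neg x y) (addb (x \in X) (y \in X)).

Section Signified.
Variables (V W : finType).

Definition signified_hom (adjG negG : rel V) (adjH negH : rel W) (f : V -> W) :=
  forall x y, adjG x y -> adjH (f x) (f y) /\ negH (f x) (f y) = negG x y.

Definition signed_hom (adjG negG : rel V) (adjH negH : rel W) :=
  exists (X : {set V}) (Y : {set W}) (f : V -> W),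
    signified_hom adjG (resign negG X) adjH (resign negH Y) f.

(* ---- Planarity, combinatorially (rotation systems / genus-0 maps). ----
   Darts are ordered pairs (x,y) with xy an edge.  A combinatorial embedding
   is a rotation [sigma] (a permutation of darts fixing the tail, cyclic on
   the darts at each vertex) together with the dart reversal [alpha].
   Faces are the orbits of [sigma \o alpha].  The embedding is planar iff the
   Euler formula  #vertex-orbits - #edges + #faces = 2 * #components  holds
   (equivalently every component has genus 0); with #edges = #darts / 2 this
   is  2 (#vertex-orbits + #faces) = 4 #components + #darts. *)
Definition dart (adj : rel V) := {p : V * V | adj p.1 p.2}.

Definition planar (adj : rel V) : Prop :=
  exists (sigma alpha : dart adj -> dart adj),
    [/\ forall d, val (alpha d) = ((val d).2, (val d).1),
        injective sigma,
        forall d, (val (sigma d)).1 = (val d).1,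
        forall d d', (val d).1 = (val d').1 -> fconnect sigma d d' &
        let comp := fun d d' : dart adj =>
          [|| sigma d == d', sigma d' == d, alpha d == d' | alpha d' == d] in
        2 * (fcard sigma predT + fcard (sigma \o alpha) predT)
          = 4 * n_comp comp predT + #|{: dart adj}| ].

End Signified.

(* ---- The finite field F_9 = F_3[i], i^2 = -1 (X^2+1 is irreducible over
   F_3), elements (a,b) standing for a + b i. ---- *)
Definition F9 : finType := ('F_3 * 'F_3)%type.
Definition f9sub (x y : F9) : F9 := ((x.1 - y.1)%R, (x.2 - y.2)%R).
Definition f9mul (x y : F9) : F9 :=
  ((x.1 * y.1 - x.2 * y.2)%R, (x.1 * y.2 + x.2 * y.1)%R).
Definition f9square (y : F9) : bool := [exists z : F9, f9mul z z == y].

Definition SP9p_adj : rel (option F9) := fun u v =>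
  match u, v with
  | Some x, Some y => x != y
  | Some _, None | None, Some _ => true
  | None, None => false
  end.
Definition SP9p_neg : rel (option F9) := fun u v =>
  match u, v with
  | Some x, Some y => ~~ f9square (f9sub y x)
  | _, _ => false
  end.

(* Main.v *)
(* If an edge xy of a planar graph is mapped to the edge ab of H, stack a path p1 ... p5 on xy (each p_i joined to x and y)
   whose edges alternate in sign: such a path takes at least 4 distinct values,
   all lying in one of the two classes {c | ac and bc have equal / opposite
   signs}.  Two such paths, one per class, force 4 + 4 vertices among the 8
   others of H, so every c is a common neighbour of a and b and both classes have
   size exactly 4.  Three rounds of stacking on all edges reach every pair, so H
   is complete and is a symmetric conference matrix of order 10.  Switching one
   vertex to be all positive, the positive graph on the other 9 is strongly
   regular with parameters (9, 4, 1, 2), hence the 3 x 3 grid; since the squares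
   of F_9 are the a + b i with a = 0 or b = 0, this is the Paley graph.

   Planarity is handled through triangulations of the sphere: stacking a vertex
   into a face keeps all faces triangular and preserves E = 3 V - 6. *)
Require Import Defs.
From HB Require Import structures.
From mathcomp Require Import all_boot all_order all_algebra.
From mathcomp Require Import zify.
Set Implicit Arguments. Unset Strict Implicit. Unset Printing Implicit Defensive.

(** * Triangulations of the sphere *)

Section Planarity.
Variables (V : finType) (adj : rel V) (apex : V -> V -> V).

(* [apex x y] is the third vertex of the face to the left of the dart xy, so
   the face permutation is (x, y) |-> (y, apex x y) and the link of x is traced
   by y |-> apex y x.  The last clause is Euler's formula E = 3 V - 6. *)
Definition triangulation :=
  [/\ forall x y, adj x y -> adj y (apex x y) /\ apex y (apex x y) = x,
      forall x y y', adj x y -> adj x y' -> fconnect (apex^~ x) y y',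
      forall x y, connect adj x y,
      forall x, exists y, adj x y &
      \sum_(x : V) \sum_(y : V) adj x y + 12 = 6 * #|V|].

Lemma planar_triangulation :
  symmetric adj -> irreflexive adj -> triangulation -> planar adj.
Proof.
move=> adjC adjI [faceP linkP adj_conn adj_ex euler].
have sig_adj (d : dart adj) : adj (val d).1 (apex (val d).2 (val d).1).
  have := valP d; rewrite adjC => /faceP[]; by [].
have al_adj (d : dart adj) : adj (val d).2 (val d).1.
  by rewrite adjC; apply: valP d.
pose sigma (d : dart adj) : dart adj :=
  exist _ ((val d).1, apex (val d).2 (val d).1) (sig_adj d).
pose alpha (d : dart adj) : dart adj :=
  exist _ ((val d).2, (val d).1) (al_adj d).
exists sigma, alpha.
have alphaK : involutive alpha by move=> d; apply: val_inj; case: d => [[]].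
have apexK x y : adj x y -> apex (apex x y) x = y.
  move=> xy; have [yz e1] := faceP _ _ xy; have [zx e2] := faceP _ _ yz.
  by rewrite -{2}e1.
have sigma_inj : injective sigma.
  move=> [[x y] /= xy] [[x' y'] /= xy'] /(congr1 val)[/= ex e].
  apply: val_inj => /=; move: xy xy' e; rewrite -ex ![adj x _]adjC.
  by move=> /faceP[_ h1] /faceP[_ h2] e; rewrite -[y]h1 -[y']h2 e.
have sigma_conn d d' : (val d).1 = (val d').1 -> fconnect sigma d d'.
  move=> e; have := valP d'; rewrite -e => /(linkP _ _ _ (valP d)) h.
  rewrite -(_ : iter (findex (apex^~ (val d).1) (val d).2 (val d').2) sigma d = d')
    ?fconnect_iter //.
  apply: val_inj.
  have it n : val (iter n sigma d) = ((val d).1, iter n (apex^~ (val d).1) (val d).2).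
    by elim: n => [|n IH] /=; [case: (val d) | rewrite IH].
  by rewrite it iter_findex // e; case: (val d').
split=> //.
(* [phi] sends the dart xy to the dart from y to [apex x y], so its orbits are the triangles. *)
set phi := sigma \o alpha.
have phi_inj : injective phi by apply: inj_comp => //; apply: can_inj alphaK.
have nV : fcard sigma predT = #|V|.
  have symS := fconnect_sym sigma_inj.
  have -> : fcard sigma predT = #|[set d : dart adj | froots sigma d]|.
    by apply: eq_card => d; rewrite !inE andbT.
  rewrite -(@card_in_imset _ _ (fun d : dart adj => (val d).1)) => [|d d'].
    apply: eq_card => x; rewrite !inE; have [y xy] := adj_ex x.
    pose d : dart adj := exist _ (x, y) xy.
    apply/imsetP; exists (froot sigma d); first by rewrite inE; apply: roots_root.
    have /(fconnect_invariant (k := fun d => (val d).1)) h :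
      fconnect sigma d (froot sigma d) by apply: connect_root.
    by rewrite -h // => u; apply/eqP.
  rewrite !inE => /eqP r1 /eqP r2 /sigma_conn/(fingraph.rootP symS).
  by rewrite r1 r2.
have nF : fcard phi predT * 3 = #|{: dart adj}|.
  apply: fcard_order_set => //; apply/subsetP=> d _; rewrite inE.
  have dE: val (phi d) = ((val d).2, apex (val d).1 (val d).2) by [].
  have d2E: val (phi (phi d)) = (apex (val d).1 (val d).2, (val d).1).
    by rewrite /=; have [_ ->] := faceP _ _ (valP d).
  have d3E: phi (phi (phi d)) = d.
    apply: val_inj; rewrite [LHS]/=; have [_ ->] := faceP _ _ (valP d).
    by rewrite (apexK _ _ (valP d)) -surjective_pairing.
  have cyc : fcycle phi [:: d; phi d; phi (phi d)] by rewrite /= d3E !eqxx.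
  have ne d' : d' != phi d'.
    apply/eqP => /(congr1 (fun d : dart adj => (val d).1)) /= e.
    by have := valP d'; rewrite /= -e adjI.
  have u : uniq [:: d; phi d; phi (phi d)].
    rewrite /= !inE negb_or andbT !ne /= andbT.
    by apply/eqP=> e; move: d3E; rewrite -e => /eqP; rewrite eq_sym (negPf (ne _)).
  by rewrite (order_cycle cyc u) // mem_head.
pose comp (d d' : dart adj) :=
  [|| sigma d == d', sigma d' == d, alpha d == d' | alpha d' == d].
have nC : n_comp comp predT = (0 < #|V|).
  have symC : connect_sym comp.
    apply: sym_connect_sym => d d'; rewrite /comp.
    by do 4!case: (_ == _).
  have cs d d' : fconnect sigma d d' -> connect comp d d'.
    apply: connect_sub => u v /eqP<-; apply: connect1.
    by rewrite /comp eqxx.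
  (* A path of vertices lifts to darts: [sigma] turns around a vertex, [alpha] crosses an edge. *)
  have conn d d' : connect comp d d'.
    have /connectP[p] := adj_conn (val d).1 (val d').1.
    elim: p d => [|x p IH] d /=; first by move=> _ /esym/sigma_conn; apply: cs.
    case/andP=> dx px e; pose d1 : dart adj := exist (fun q => adj q.1 q.2) (_, _) dx.
    have: connect comp d d1 by apply/cs/sigma_conn.
    move=> h; apply: connect_trans h _.
    apply: (@connect_trans _ _ (alpha d1)).
      by apply: connect1; rewrite /comp eqxx !orbT.
    by apply: IH.
  case: (posnP #|V|) => [V0|].
    apply: eq_card0 => d; have := card0_eq V0 (val d).1; by rewrite inE.
  move=> /card_gt0P[x _]; have [y xy] := adj_ex x.
  rewrite -[RHS]/1 -(n_comp_connect symC (exist _ (x, y) xy)); apply: eq_n_comp_r => d.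
  by rewrite !inE conn.
(* Euler's formula excludes the empty graph, for which it would read 12 = 0. *)
have V0 : 0 < #|V| by case: posnP euler => // ->; rewrite addnC.
have nD : #|{: dart adj}| = \sum_(x : V) \sum_(y : V) adj x y.
  rewrite card_sig pair_big /= -sum1_card big_mkcond /=.
  by apply: eq_bigr => p _; rewrite unfold_in; case: (adj _ _).
change (2 * (fcard sigma predT + fcard phi predT)
  = 4 * n_comp comp predT + #|{: dart adj}|).
rewrite nV nC V0; move: nF; rewrite nD; move: euler; set s := \sum_x _; set f := fcard _ _; lia.
Qed.

End Planarity.

(** * Stacking a new vertex into a triangular face *)

Section Stack.
Variables (V : finType) (adj neg : rel V) (apex : V -> V -> V).
Hypotheses (adjC : symmetric adj) (adjI : irreflexive adj).
Hypotheses (negC : symmetric neg) (triV : triangulation adj apex).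
Variables (x0 y0 : V) (e : V -> bool).
Hypothesis adj0 : adj x0 y0.

Let z0 := apex x0 y0.
Let corner x := [|| x == x0, x == y0 | x == z0].
Let next x := if x == x0 then y0 else if x == y0 then z0 else x0.
Let boundary x y := corner x && (y == next x).

Definition stack_adj : rel (option V) := fun u v =>
  match u, v with
  | Some x, Some y => adj x y
  | Some x, None | None, Some x => corner x
  | None, None => false
  end.

Definition stack_neg : rel (option V) := fun u v =>
  match u, v with
  | Some x, Some y => neg x y
  | Some x, None | None, Some x => e x
  | None, None => false
  end.

(** The darts of the chosen face now have the new vertex [None] on their left; every other old dart
    keeps its face. Applying [next] twice gives the preceding corner. *)
Definition stack_apex (u v : option V) : option V :=
  match u, v with
  | Some x, Some y => if boundary x y then None else Some (apex x y)
  | Some x, None => Some (next (next x))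
  | None, Some x => Some (next x)
  | None, None => None
  end.

Lemma stack_adjC : symmetric stack_adj.
Proof. by case=> [x|] [y|] //=; apply: adjC. Qed.

Lemma stack_adjI : irreflexive stack_adj.
Proof. by case=> [x|] //=; apply: adjI. Qed.

Lemma stack_negC : symmetric stack_neg.
Proof. by case=> [x|] [y|] //=; apply: negC. Qed.

Lemma stack_apex0 : stack_apex (Some x0) (Some y0) = None.
Proof. by rewrite /= /boundary /corner /next !eqxx. Qed.

Let adj_neq x y : adj x y -> x != y.
Proof. by apply: contraTneq => ->; rewrite adjI. Qed.

Let face0 : [/\ adj y0 z0, adj z0 x0, apex y0 z0 = x0 & apex z0 x0 = y0].
Proof.
have [faceP _ _ _ _] := triV.
have [yz ez] := faceP _ _ adj0; have [zx ex] := faceP _ _ yz.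
by rewrite -/z0 in yz ez zx ex; rewrite ez in zx ex.
Qed.

Let nextE : [/\ next x0 = y0, next y0 = z0 & next z0 = x0].
Proof.
have [/adj_neq yz /adj_neq zx _ _] := face0; have xy := adj_neq adj0.
by rewrite /next !eqxx [y0 == x0]eq_sym (negPf xy) (negPf zx) [z0 == y0]eq_sym
  (negPf yz).
Qed.

Let nextP x : corner x ->
  [/\ adj x (next x), apex x (next x) = next (next x), corner (next x) &
      next (next (next x)) = x].
Proof.
have [yz zx ey ez] := face0; have [n1 n2 n3] := nextE.
by case/or3P=> /eqP->; rewrite !(n1, n2, n3) /corner !eqxx ?orbT.
Qed.

Let cornerE : forall x, corner x = (x \in [:: x0; y0; z0]).
Proof. by move=> x; rewrite !inE. Qed.

(** In the link of a corner, [None] is inserted between the preceding and the following corner; the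
    link of [None] is the cycle of the three corners. One vertex and six darts are added, which
    preserves Euler's formula. *)
Lemma stack_triangulation : triangulation stack_adj stack_apex.
Proof.
have [faceP linkP conn nbr euler] := triV; split.
- move=> [x|] [y|] //=.
  + move=> xy; have [y_z z_x] := faceP _ _ xy.
    case: ifP => [/andP[cx /eqP->]|nb]; first by have [_ _ ? e3] := nextP cx; rewrite /= e3.
    rewrite /= ifN ?z_x //; apply: contraFN nb => /andP[cy /eqP zE].
    have [_ e1 c1 e3] := nextP cy; rewrite zE e1 in z_x.
    by rewrite /boundary -z_x e3 eqxx; have [_ _ ->] := nextP c1.
  + move=> cx; have [_ _ c1 e3] := nextP cx; have [_ _ c2 _] := nextP c1.
    by rewrite e3.
  + by move=> cx; have [? _ _ _] := nextP cx; rewrite /boundary cx eqxx.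
- have stepN x : corner x ->
    fconnect (stack_apex^~ (Some x)) None (Some (next x)) /\
    fconnect (stack_apex^~ (Some x)) (Some (next (next x))) None.
    move=> cx; split; first exact: (fconnect1 (stack_apex^~ (Some x)) None).
    have [_ _ c1 e3] := nextP cx; have [_ _ c2 _] := nextP c1.
    apply: connect1; rewrite /= /boundary c2 e3 !eqxx; by [].
  (* A step in the old link of x either survives or leads from the preceding to the following
     corner; in the latter case it becomes a detour through [None]. *)
  have lift x y y' : adj x y -> adj x y' ->
      fconnect (stack_apex^~ (Some x)) (Some y) (Some y').
    move=> xy /(linkP _ _ _ xy); move: xy => _ /connectP[p].
    elim: p y => [|u p IH] y /=; first by move=> _ ->; apply: connect0.
    case/andP=> /eqP yu pu /(IH _ pu); apply: connect_trans.
    case cb: (boundary y x); last by apply: connect1; rewrite /= cb yu.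
    case/andP: cb => cy /eqP xE.
    have [_ e1 cx e3] := nextP cy; rewrite -xE in e1 cx e3.
    have [e4 e5] := stepN _ cx; rewrite e3 in e5.
    by rewrite -yu e1; apply: connect_trans e5 e4.
  have nn x : corner x -> adj x (next (next x)).
    move=> cx; have [_ _ c1 e3] := nextP cx; have [_ _ c2 _] := nextP c1.
    by rewrite adjC -{2}e3; have [] := nextP c2.
  move=> [x|] [y|] [y'|] //=.
  + exact: lift.
  + move=> xy cx; have [_ e5] := stepN _ cx; apply: connect_trans e5.
    by apply: lift => //; apply: nn.
  + move=> cx xy; have [e4 _] := stepN _ cx; apply: connect_trans e4 _.
    by apply: lift => //; have [] := nextP cx.
  + move=> c c'.
    have st x : fconnect (stack_apex^~ None) (Some x) (Some (next (next x))).
      exact: (fconnect1 (stack_apex^~ None) (Some x)).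
    have [_ _ c1 e3] := nextP c.
    have: [|| y' == y, y' == next y | y' == next (next y)].
      have [n1 n2 n3] := nextE; move: c c'.
      by do 2!case/or3P=> /eqP->; rewrite !(n1, n2, n3) eqxx ?orbT.
    case/or3P=> /eqP->; [exact: connect0 | | exact: st].
    by apply: connect_trans (st _) _; rewrite -{2}e3; apply: st.
- have some x y : connect stack_adj (Some x) (Some y).
    have /connectP[p] := conn x y.
    elim: p x => [|u p IH] x /=; first by move=> _ ->; apply: connect0.
    by case/andP=> xu pu /(IH _ pu); apply: connect_trans; apply: connect1.
  have x0N : stack_adj (Some x0) None by rewrite /= /corner eqxx.
  have Nx0 : stack_adj None (Some x0) by rewrite stack_adjC.
  move=> [x|] [y|]; first exact: some; last exact: connect0.
  + exact: connect_trans (some x x0) (connect1 x0N).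
  + exact: connect_trans (connect1 Nx0) (some x0 y).
- move=> [x|]; last by exists (Some x0); rewrite /= /corner eqxx.
  by have [y xy] := nbr x; exists (Some y).
have sumO (F : option V -> nat) : \sum_u F u = F None + \sum_x F (Some x).
  rewrite (bigD1 None) //=; congr (_ + _).
  rewrite (reindex_omap (@Some V) id) /=; last by case.
  by apply: eq_bigl => x; rewrite eqxx.
have c3 : \sum_x corner x = 3.
  rewrite -(_ : #|[:: x0; y0; z0]| = 3).
    rewrite -sum1_card [RHS]big_mkcond /=; apply: eq_bigr => x _.
    by rewrite cornerE; case: (_ \in _).
  rewrite (card_uniqP _) //=; rewrite !inE negb_or.
  have [yz zx _ _] := face0.
  by rewrite (adj_neq adj0) (adj_neq yz) eq_sym (adj_neq zx).
rewrite card_option sumO sumO /= c3.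
under eq_bigr do rewrite sumO /=.
rewrite big_split /= c3 mulnS -euler; set s := (\sum_i _); lia.
Qed.

End Stack.

(** * Signed triangulations and fans *)

Record signed_triangulation := SignedTriangulation {
  vertex :> finType;
  edge : rel vertex;
  sgn : rel vertex;
  third : vertex -> vertex -> vertex;
  edgeC : symmetric edge;
  edgeI : irreflexive edge;
  sgnC : symmetric sgn;
  thirdP : triangulation edge third }.

Implicit Types M : signed_triangulation.

Definition stack M (x0 y0 : M) (e : M -> bool) (xy0 : edge x0 y0) :=
  SignedTriangulation (stack_adjC (@third M) (@edgeC M) x0 y0)
    (stack_adjI (@third M) (@edgeI M) x0 y0) (stack_negC (@sgnC M) e)
    (stack_triangulation (@edgeC M) (@edgeI M) (thirdP M) xy0).

Lemma triangle_exists : exists M (x y : M), edge x y.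
Proof.
pose adj : rel 'I_3 := fun x y => x != y.
(* The three residues modulo 3 sum to 0, so this is the remaining vertex; both sides of the triangle
   are faces. *)
pose apex (x y : 'I_3) : 'I_3 := (- x - y)%R.
have adjC : symmetric adj by move=> x y; rewrite /adj eq_sym.
have adjI : irreflexive adj by move=> x; rewrite /adj eqxx.
have tri : triangulation adj apex.
  split.
  - by move=> [[|[|[|//]]] ?] [[|[|[|//]]] ?] //= _; split=> //; apply/eqP.
  - move=> x y y' xy xy'.
    have: (y' == y) || (y' == apex y x).
      by move: x y y' xy xy' => [[|[|[|//]]] ?] [[|[|[|//]]] ?] [[|[|[|//]]] ?].
    by case/orP=> /eqP->; [apply: connect0 | apply: (fconnect1 (apex^~ x))].
  - move=> x y; have [->|/(connect1 (e := adj))//] := eqVneq x y.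
    exact: connect0.
  - by move=> x; exists (x + 1)%R; move: x => [[|[|[|//]]] ?].
  - by rewrite card_ord !big_ord_recl !big_ord0.
exists (SignedTriangulation adjC adjI (sgn := fun _ _ => false) (fun _ _ => erefl) tri).
by exists ord0, ord_max.
Qed.

Definition extension M M' (i : M -> M') :=
  forall x y, edge x y -> edge (i x) (i y) /\ sgn (i x) (i y) = sgn x y.

Lemma extension_id M : extension (@id M).
Proof. by []. Qed.

Lemma extension_comp M1 M2 M3 (i : M1 -> M2) (j : M2 -> M3) :
  extension i -> extension j -> extension (j \o i).
Proof. by move=> ei ej x y /ei[/ej[? ->]]. Qed.

Lemma extension_stack M x0 y0 e xy0 :
  extension (Some : M -> @stack M x0 y0 e xy0).
Proof. by []. Qed.

(* [es] and [ps] are listed from the last stacked vertex to the first; in an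
   entry [(t, c)], [t] is the sign of yp and [c] that of the edge from p to the
   vertex stacked just before it. *)
Fixpoint fan M (x y : M) (es : seq (bool * bool)) (ps : seq M) : Prop :=
  match es, ps with
  | (t, c) :: es', p :: ps' =>
    [/\ edge x p /\ sgn x p = false, edge y p /\ sgn y p = t,
        if ps' is q :: _ then edge p q /\ sgn p q = c else True &
        fan x y es' ps']
  | [::], [::] => True
  | _, _ => False
  end.

Lemma fan_extension M M' (i : M -> M') x y es ps :
  extension i -> fan x y es ps -> fan (i x) (i y) es (map i ps).
Proof.
move=> ei; elim: es ps => [|[t c] es IH] [|p ps] //= [] [/ei[? ->]] ?.
move=> [/ei[? ->]] ? h hf; split=> //; last exact: IH.
by case: ps h {IH hf} => //= q _ [/ei[? ->]] ?.
Qed.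

(** Each new vertex is stacked into the face to the left of xy. It then becomes the third vertex of
    that face, so the next one is adjacent to it; the last clause is the invariant that carries this
    induction. *)
Lemma fan_exists M (x y : M) es : edge x y ->
  exists M' (i : M -> M'), extension i /\
  exists ps, fan (i x) (i y) es ps /\
    (if ps is p :: _ then third (i x) (i y) = p else True).
Proof.
move=> xy; elim: es => [|[t c] es [M' [i [ei [ps [psP hd]]]]]].
  by exists M, id; split; [apply: extension_id | exists [::]].
have [xy' _] := ei _ _ xy.
have yx' : i x != i y by apply: contraTneq xy' => ->; rewrite edgeI.
have [faceP _ _ _ _] := thirdP M'.
have [yz zx] := faceP _ _ xy'; have := faceP _ _ yz; rewrite zx => -[zx' _].
have yz' : i y != third (i x) (i y).
  by apply: contraTneq yz => {1}<-; rewrite edgeI.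
have zx'' : third (i x) (i y) != i x by apply: contraTneq zx' => ->; rewrite edgeI.
(* The remaining corner is the vertex stacked just before, if there is one. *)
pose e z := if z == i y then t else if z == i x then false else c.
pose M2 := stack e xy'; pose j : M' -> M2 := Some.
have ej : extension j by apply: extension_stack.
exists M2, (j \o i); split; first exact: extension_comp.
exists ((None : M2) :: map j ps); split; last exact: stack_apex0.
split; last exact: fan_extension.
- by rewrite /= /e eqxx (negPf yx').
- by rewrite /= /e eqxx orbT.
- case: ps hd {psP} => //= p _ <-; rewrite /e eqxx !orbT.
  by rewrite eq_sym (negPf yz') (negPf zx'').
Qed.

Lemma alternating_walk (T : finType) (col : rel T) (b : bool) c1 c2 c3 c4 c5 :
  symmetric col -> c1 != c2 -> c2 != c3 -> c3 != c4 -> c4 != c5 ->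
  col c1 c2 = b -> col c2 c3 = ~~ b -> col c3 c4 = b -> col c4 c5 = ~~ b ->
  3 < #|[set c in [:: c1; c2; c3; c4; c5]]|.
Proof.
move=> colC n12 n23 n34 n45 e12 e23 e34 e45.
(* Terms two steps apart differ, because the pairs they form with the middle term have different
   colours. *)
have nb x y z : col x y = b -> col y z = ~~ b -> x != z.
  by move=> xy yz; apply: contraTneq isT => xz; move: yz; rewrite -xz colC xy; case: (b).
have nb' x y z : col x y = ~~ b -> col y z = b -> x != z.
  by move=> xy yz; rewrite eq_sym; apply: (nb _ y); rewrite colC.
have card4 d1 d2 d3 d4 : uniq [:: d1; d2; d3; d4] ->
    {subset [:: d1; d2; d3; d4] <= [:: c1; c2; c3; c4; c5]} ->
    3 < #|[set c in [:: c1; c2; c3; c4; c5]]|.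
  move=> /card_uniqP /= <- sub; apply/subset_leq_card/subsetP => d /sub.
  by rewrite !inE.
(* Only c1 and c4 can still coincide among the first four terms; if they do, c5 takes the place of
   c4. *)
have [e|n14] := eqVneq c1 c4.
  subst c4; apply: (card4 c1 c2 c3 c5).
    have e21 : col c2 c1 = b by rewrite colC.
    rewrite /= !inE !negb_or n12 n23 n45 (nb _ _ _ e12 e23).
    by rewrite (nb _ _ _ e21 e45) (nb _ _ _ e34 e45).
  by move=> d; rewrite !inE => /or4P[]->; rewrite ?orbT.
apply: (card4 c1 c2 c3 c4).
  rewrite /= !inE !negb_or n12 n23 n34 n14 (nb _ _ _ e12 e23).
  by rewrite (nb' _ _ _ e23 e34).
by move=> d; rewrite !inE => /or4P[]->; rewrite ?orbT.
Qed.

Lemma fan_size M (x y : M) es ps : fan x y es ps -> size ps = size es.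
Proof. by elim: es ps => [|[t c] es IH] [|p ps] //= [_ _ _ /IH->]. Qed.

Lemma fan_mem M (x y : M) es ps p :
  fan x y es ps -> p \in ps -> edge x p /\ edge y p.
Proof.
elim: es ps => [|[t c] es IH] [|q ps] //= [[xq _] [yq _] _ psP].
by rewrite inE => /orP[/eqP-> // | /(IH _ psP)].
Qed.

Lemma fan_cat M (x y : M) es1 es2 ps :
  fan x y (es1 ++ es2) ps ->
  exists ps1 ps2, [/\ ps = ps1 ++ ps2, fan x y es1 ps1 & fan x y es2 ps2].
Proof.
elim: es1 ps => [|[t c] es1 IH] ps /=; first by exists [::], ps.
case: ps => [|p ps] //= [xp yp pq /IH[ps1 [ps2 [ps12 ps1P ps2P]]]].
exists (p :: ps1), ps2; split=> //=; first by rewrite ps12.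
by split=> //; move: pq; rewrite ps12; case: (ps1).
Qed.

(** * Forcing the target *)

(** The columns in which rows a and b of the sign matrix agree ([t] false) or differ ([t] true).
    Resigning at most exchanges the two classes. *)
Definition sign_class (W : finType) (neg : rel W) (a b : W) (t : bool) : {set W} :=
  [set c | [&& c != a, c != b & neg a c (+) neg b c == t]].

Section Target.
Variables (W : finType) (adj neg : rel W).
Hypotheses (adjC : symmetric adj) (adjI : irreflexive adj) (negC : symmetric neg).

(** A signed homomorphism with both resignings gathered on the source: the one of the target is
    pulled back along [f] and absorbed in [s]. *)
Definition switching_hom M (f : M -> W) (s : M -> bool) :=
  forall x y, edge x y ->
    adj (f x) (f y) /\ neg (f x) (f y) = sgn x y (+) (s x (+) s y).

Lemma switching_hom_extension M M' (i : M -> M') f s :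
  extension i -> switching_hom f s -> switching_hom (f \o i) (s \o i).
Proof. by move=> ei h x y /ei[/h[? ->] ->]. Qed.

Lemma fan_sign_class M (x y : M) t b ps f s :
  edge x y -> switching_hom f s ->
  fan x y [:: (t, ~~ b); (t, b); (t, ~~ b); (t, b); (t, ~~ b)] ps ->
  let S := [set c in map f ps] in
  3 < #|S| /\ S \subset sign_class neg (f x) (f y) (t (+) (s x (+) s y)).
Proof.
move=> xy hom psP; have := fan_size psP.
case: ps psP => [|p1 [|p2 [|p3 [|p4 [|p5 [|]]]]]] //= + _.
move=> [[xp1 sx1] [yp1 sy1] [e12 s12]].
move=> [[xp2 sx2] [yp2 sy2] [e23 s23]] [[xp3 sx3] [yp3 sy3] [e34 s34]].
move=> [[xp4 sx4] [yp4 sy4] [e45 s45]] [[xp5 sx5] [yp5 sy5] _ _].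
have neq u v : edge u v -> f u != f v.
  by move=> /hom[+ _]; apply: contraTneq => ->; rewrite adjI.
split.
  (* [col c d] is the sign of the triangle on f x, c, d. Triangle signs are invariant under
     resigning, and all edges from x to the fan are positive, so on the fan path [col] reproduces
     the prescribed alternating signs. *)
  pose col c d := neg c d (+) (neg (f x) c (+) neg (f x) d).
  have colE p q : edge x p -> edge x q -> edge p q ->
      sgn x p = false -> sgn x q = false -> col (f p) (f q) = sgn p q.
    move=> /hom[_ np] /hom[_ nq] /hom[_ npq] sp sq.
    rewrite /col np nq npq sp sq.
    by case: (s x) (s p) (s q) (sgn p q) => [] [] [] [].
  apply: (@alternating_walk _ col (~~ b)); rewrite ?neq ?colE ?negbK //.
  by move=> c d; rewrite /col negC; congr (_ (+) _); apply: addbC.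
have inS p : edge x p -> edge y p -> sgn x p = false -> sgn y p = t ->
    f p \in sign_class neg (f x) (f y) (t (+) (s x (+) s y)).
  move=> xp yp sp tp; rewrite inE ![f p == _]eq_sym !neq //=.
  have [_ ->] := hom _ _ xp; have [_ ->] := hom _ _ yp; rewrite sp tp.
  by case: (t) (s x) (s y) (s p) => [] [] [] [].
apply/subsetP=> c; rewrite in_set /= !in_cons in_nil orbF.
by case/or4P=> [||| /orP[]] /eqP->; apply: inS.
Qed.

(** * Targets with ten vertices *)

Hypothesis card10 : #|W| = 10.

Definition covering M (x y : M) (f : M -> W) :=
  forall c, c != f x -> c != f y -> exists w, [/\ edge x w, edge y w & f w = c].

Definition halved (a b : W) := forall t, #|sign_class neg a b t| = 4.

Lemma halving_gadget M (x y : M) : edge x y ->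
  exists M' (i : M -> M'), extension i /\ forall f s, switching_hom f s ->
    covering (i x) (i y) f /\ halved (f (i x)) (f (i y)).
Proof.
move=> xy; pose es t : seq (bool * bool) :=
  [:: (t, ~~ false); (t, false); (t, ~~ false); (t, false); (t, ~~ false)].
(* The two halves of this fan have opposite signs towards y, so their images fall into the two
   complementary sign classes. *)
have [M' [i [ei [ps [psP _]]]]] := fan_exists (es true ++ es false) xy.
exists M', i; split=> // f s hom; move: psP; have [xy' _] := ei _ _ xy.
move: {xy ei} (i x) (i y) xy' => {}x {}y xy psP.
have [ps1 [ps2 [_ ps1P ps2P]]] := fan_cat psP.
have [] := fan_sign_class xy hom ps1P; have [] := fan_sign_class xy hom ps2P.
set S2 := [set c in _]; set S1 := [set c in map f ps1]; set k := s x (+) s y.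
rewrite addFb addTb => ge2 sub2 ge1 sub1.
have ab : f x != f y.
  by have [+ _] := hom _ _ xy; apply: contraTneq => ->; rewrite adjI.
set a := f x; set b := f y; pose C := sign_class neg a b.
have CE : C k :|: C (~~ k) = ~: [set a; b].
  apply/setP=> c; rewrite !inE negb_or.
  by do 2![case: (c == _)] => //=; case: (_ (+) _); case: (k).
have disj : #|C k :&: C (~~ k)| = 0.
  apply/eqP; rewrite cards_eq0; apply/eqP/setP=> c; rewrite !inE.
  by do 2![case: (c == _)] => //=; case: (_ (+) _); case: (k).
have C8 : #|C k| + #|C (~~ k)| = 8.
  have := cardsUI (C k) (C (~~ k)); rewrite disj addn0 => <-.
  by rewrite CE cardsCs setCK cards2 card10 [a != b]ab.
have le1 := subset_leq_card sub1; have le2 := subset_leq_card sub2.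
rewrite -/a -/b -/(C _) in le1 le2 sub1 sub2.
(* Two lower bounds of 4 against a total of 8 leave no slack: both classes have size 4 and are
   filled by fan images, which gives the covering. *)
have tight u v p q :
    u + v = 8 -> 3 < p -> 3 < q -> p <= v -> q <= u -> [/\ v <= p, u <= q, u = 4 & v = 4].
  by move=> *; split; lia.
have [leC1 leC2 C4 C4'] := tight _ _ _ _ C8 ge1 ge2 le1 le2.
have E2 : S2 = C k by apply/eqP; rewrite eqEcard sub2.
have E1 : S1 = C (~~ k) by apply/eqP; rewrite eqEcard sub1.
split.
  move=> c ca cb; have : c \in C k :|: C (~~ k).
    by rewrite CE !inE negb_or ca cb.
  rewrite -E1 -E2 !inE => /orP[]/mapP[w wp ->].
    by have [? ?] := fan_mem ps2P wp; exists w.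
  by have [? ?] := fan_mem ps1P wp; exists w.
by move=> t; rewrite -/(C t); case: t (k) C4 C4' => [] [].
Qed.

(** The gadgets are attached to the edges of [M] one after another; what was forced for earlier
    edges survives, because common neighbours are carried along by later extensions. *)
Lemma saturation M : exists M' (i : M -> M'), extension i /\
  forall f s, switching_hom f s -> forall x y, edge x y ->
    covering (i x) (i y) f /\ halved (f (i x)) (f (i y)).
Proof.
suff [M' [i [ei iP]]] : exists M' (i : M -> M'), extension i /\
    forall f s, switching_hom f s -> {in enum {: M * M}, forall p, edge p.1 p.2 ->
      covering (i p.1) (i p.2) f /\ halved (f (i p.1)) (f (i p.2))}.
  exists M', i; split=> // f s hom x y.
  by apply: (iP f s hom (x, y)); rewrite mem_enum.
elim: (enum _) => [|[x y] r [M1 [i [ei iP]]]].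
  by exists M, id; split; first exact: extension_id.
case xy: (edge x y); last first.
  exists M1, i; split=> // f s hom p; rewrite inE => /orP[/eqP-> /=|pr].
    by rewrite xy.
  exact: (iP f s).
have [/halving_gadget[M2 [j [ej jP]]] _] := ei _ _ xy.
exists M2, (j \o i); split; first exact: extension_comp.
move=> f s hom p; rewrite inE => /orP[/eqP-> /= _|pr uv]; first exact: jP hom.
have [cov ha] := iP _ _ (switching_hom_extension ej hom) p pr uv.
split=> // c c1 c2; have [w [w1 w2 wc]] := cov c c1 c2.
by exists (j w); split=> //; [have [] := ej _ _ w1 | have [] := ej _ _ w2].
Qed.

Lemma complete_and_halved :
  (forall M, exists f s, @switching_hom M f s) ->
  forall a b, a != b -> adj a b /\ halved a b.
Proof.
move=> univ; have [M0 [x [y xy]]] := triangle_exists.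
have [M1 [i1 [e1 P1]]] := saturation M0.
have [M2 [i2 [e2 P2]]] := saturation M1.
have [M3 [i3 [e3 P3]]] := saturation M2.
have [f3 [s3 hom3]] := univ M3.
have hom2 := switching_hom_extension e3 hom3.
have hom1 := switching_hom_extension e2 hom2.
set f2 := f3 \o i3 in hom2 hom1; set f1 := f2 \o i2 in hom1.
(* The third round halves every pair that is the image of an edge of [M2]; the first two rounds
   serve to make every pair such an image. *)
have good u v : edge u v -> adj (f2 u) (f2 v) /\ halved (f2 u) (f2 v).
  by move=> uv; have [? _] := hom2 _ _ uv; have [] := P3 _ _ hom3 _ _ uv.
have haveC a b : halved a b -> halved b a.
  move=> ab t; rewrite -(ab t); apply: eq_card => c.
  by rewrite !inE addbC; do 2!case: (_ == _).
set a0 := f1 (i1 x); set b0 := f1 (i1 y).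
have [xy1 _] := e1 _ _ xy.
(* First round: every vertex other than a0 is the image of a neighbour of x. *)
have near c : c != a0 -> exists2 w : M1, edge (i1 x) w & f1 w = c.
  move=> ca; have [->|cb] := eqVneq c b0; first by exists (i1 y).
  have [cov _] := P1 _ _ hom1 _ _ xy.
  by have [w [? _ ?]] := cov c ca cb; exists w.
have from_a0 c : c != a0 -> adj a0 c /\ halved a0 c.
  by move=> /near[w /e2[xw _] <-]; apply: good.
move=> a b ab; have [aE|aa] := eqVneq a a0.
  by rewrite aE; apply: from_a0; rewrite -aE eq_sym.
have [->|ba] := eqVneq b a0.
  by have [? ?] := from_a0 _ aa; split; [rewrite adjC | apply: haveC].
(* Second round: applied to the edge xw with w above a, it yields a neighbour of w above b. *)
have [w xw wa] := near _ aa; have [cov _] := P2 _ _ hom2 _ _ xw.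
have [|w' [_ ww' <-]] := cov b ba; first by rewrite eq_sym -[f2 _]/(f1 w) wa.
by rewrite -wa; apply: good.
Qed.
End Target.

(** * Uniqueness of the conference matrix of order 10 *)

(** Resigning at c alters both ac and bc, so only the memberships of a and b matter. In particular,
    being halved is invariant under resigning. *)
Lemma sign_class_resign (W : finType) (neg : rel W) (X : {set W}) a b t :
  sign_class (resign neg X) a b t
  = sign_class neg a b (t (+) ((a \in X) (+) (b \in X))).
Proof.
apply/setP=> c; rewrite !inE /resign; do 2!congr (_ && _).
by case: (a \in X) (b \in X) (c \in X) (neg a c) (neg b c) t => [] [] [] [] [] [].
Qed.

Lemma ternary_lt m k : m < 3 -> k < 3 -> 3 * m + k < 9.
Proof. lia. Qed.

Lemma ternary_inj m k m' k' : m < 3 -> k < 3 -> m' < 3 -> k' < 3 ->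
  3 * m + k = 3 * m' + k' -> m = m' /\ k = k'.
Proof. by move=> *; split; lia. Qed.

(** * The 3 x 3 grid on the field of nine elements, and its squares *)

Definition aligned (p q : F9) := (p.1 == q.1) || (p.2 == q.2).

Definition grid_nbr (p : F9) : seq F9 :=
  [:: (p.1 + 1, p.2); (p.1 - 1, p.2); (p.1, p.2 + 1); (p.1, p.2 - 1)]%R.

Lemma grid_nbr_aligned p : {in grid_nbr p, forall q, (p != q) && aligned p q}.
Proof.
apply/allP; case: p => [[i hi] [j hj]].
by case: i hi => [|[|[|//]]] hi; case: j hj => [|[|[|//]]].
Qed.

Lemma grid_nbr_uniq p q : p != q -> ~~ aligned p q -> uniq (q :: grid_nbr p).
Proof.
case: p q => [[i hi] [j hj]] [[i' hi'] [j' hj']].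
by case: i hi => [|[|[|//]]] hi; case: j hj => [|[|[|//]]] hj;
  case: i' hi' => [|[|[|//]]] hi'; case: j' hj' => [|[|[|//]]] hj'.
Qed.

(** The square of a + b i is a^2 - b^2 + 2 a b i. If a b = 0 the imaginary part vanishes; otherwise
    a^2 = b^2 = 1 and the real part does. *)
Lemma f9squareE y : f9square y = (y.1 == 0%R) || (y.2 == 0%R).
Proof.
apply/existsP/idP => [[z /eqP<-]|].
  case: z => [[i hi] [j hj]].
  by case: i hi => [|[|[|//]]] hi; case: j hj => [|[|[|//]]].
case: y => [[i hi] [j hj]].
pose F3 (k : nat) : 'F_3 := inZp k.
case: i hi => [|[|[|//]]] hi; case: j hj => [|[|[|//]]] hj //= _.
- by exists (F3 0, F3 0).
- by exists (F3 1, F3 2).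
- by exists (F3 1, F3 1).
- by exists (F3 1, F3 0).
- by exists (F3 0, F3 1).
Qed.

(** * From a normalized conference matrix to the grid graph *)

Section NormalizedConference.
Variables (W : finType) (n : rel W) (o : W).
Hypotheses (nC : symmetric n) (n_o : forall c, c != o -> n o c = false).
Hypothesis n_halved : forall a b, a != b -> halved n a b.

Let pos x y := [&& x != o, y != o, x != y & ~~ n x y].
Let N x := [set y | pos x y].

Let posC : symmetric pos.
Proof.
move=> x y; rewrite /pos nC [x == y]eq_sym.
by case: (x == o); case: (y == o).
Qed.

Let posI x : pos x x = false.
Proof. by rewrite /pos eqxx !andbF. Qed.

Let card_N x : x != o -> #|N x| = 4.
Proof.
move=> xo; have ox : o != x by rewrite eq_sym.
rewrite -(n_halved ox false); apply: eq_card => c.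
rewrite !inE /pos xo [x == c]eq_sym; case: (eqVneq c o) => //= co.
by rewrite (n_o co) addFb eqbF_neg.
Qed.

(* Counting 2 #|N x :&: N y| = 8 - #|N x (+) N y|: away from x and y the
   symmetric difference is a sign class of xy, of size 4. *)
Let card_common x y : x != o -> y != o -> x != y ->
  #|N x :&: N y| = if pos x y then 1 else 2.
Proof.
move=> xo yo xy; pose A := sign_class n x y true.
have oA : o \notin A by rewrite inE ![n _ o]nC !n_o // !andbF.
have nx := cardsID (N y) (N x); have ny := cardsID (N x) (N y).
rewrite card_N // in nx; rewrite card_N // setIC in ny.
have dis : #|(N x :\: N y) :&: (N y :\: N x)| = 0.
  apply/eqP; rewrite cards_eq0; apply/eqP/setP=> c; rewrite !inE.
  by case: (pos x c); rewrite ?andbF.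
have := cardsUI (N x :\: N y) (N y :\: N x); rewrite dis addn0.
(* If xy is positive, x and y themselves belong to the symmetric difference, in addition to the four
   elements of [A]. *)
suff -> : #|(N x :\: N y) :|: (N y :\: N x)| = if pos x y then 6 else 4.
  by case: (pos x y); lia.
have A4 : #|A| = 4 by apply: n_halved.
have sd c : c != x -> c != y ->
    (c \in (N x :\: N y) :|: (N y :\: N x)) = (c \in A).
  move=> cx cy; rewrite !inE /pos xo yo cx cy ![_ == c]eq_sym cx cy /=.
  have [->|co /=] := eqVneq c o; first by rewrite ![n _ o]nC !n_o.
  by do 2!case: (n _ c).
case: ifP => pxy.
  have -> : 6 = #|[set x; y]| + #|A| by rewrite A4 cards2 xy.
  rewrite -cardsUI (_ : [set x; y] :&: A = set0) ?cards0 ?addn0; last first.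
    by apply/setP=> c; rewrite !inE; case: (c == x); case: (c == y).
  apply: eq_card => c; have [->|cx] := eqVneq c x.
    by rewrite !inE !posI posC pxy eqxx.
  have [->|cy] := eqVneq c y; first by rewrite !inE !posI pxy eqxx orbT.
  by rewrite sd // in_setU !inE (negPf cx) (negPf cy).
rewrite -A4; apply: eq_card => c; have [->|cx] := eqVneq c x.
  by rewrite !inE !posI posC pxy eqxx.
have [->|cy] := eqVneq c y; first by rewrite !inE !posI pxy eqxx !andbF.
exact: sd.
Qed.

Let pos_neq x y : pos x y -> [/\ x != o, y != o & x != y].
Proof. by case/and4P. Qed.

Let third_unique x y z z' :
  pos x y -> pos x z -> pos y z -> pos x z' -> pos y z' -> z = z'.
Proof.
move=> xy xz yz xz' yz'; have [xo yo nxy] := pos_neq xy.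
have /eqP/cards1P[u uE] : #|N x :&: N y| = 1 by rewrite card_common // xy.
have inu t : pos x t -> pos y t -> t = u.
  by move=> xt yt; apply/set1P; rewrite -uE !inE xt yt.
by rewrite (inu z) // (inu z').
Qed.

Let third_exists x y : pos x y -> exists z, pos x z && pos y z.
Proof.
move=> xy; have [xo yo nxy] := pos_neq xy.
have: 0 < #|N x :&: N y| by rewrite card_common // xy.
by case/card_gt0P=> z; rewrite !inE; exists z.
Qed.

Let second_common x y z : x != y -> pos x y = false -> pos z x -> pos z y ->
  exists w, [/\ w != z, pos x w & pos y w].
Proof.
move=> nxy xy zx zy; have [_ xo _] := pos_neq zx; have [_ yo _] := pos_neq zy.
have: 0 < #|(N x :&: N y) :\ z|.
  have := cardsD1 z (N x :&: N y); rewrite card_common // xy.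
  by case: (z \in _) => /= ; lia.
by case/card_gt0P=> w; rewrite !inE => /and3P[]; exists w.
Qed.

Let N_exhausted x a b c d e : pos x a -> pos x b -> pos x c -> pos x d ->
  uniq [:: e; a; b; c; d] -> pos x e = false.
Proof.
move=> xa xb xc xd u; apply/negP=> xe; have [xo _ _] := pos_neq xa.
have := card_uniqP u; apply/eqP; rewrite neq_ltn -[size _]/5.
rewrite -[5]/(4.+1) ltnS -{1}(card_N xo) subset_leq_card //.
apply/subsetP=> y; rewrite !inE.
by case/orP=> [|/or4P[]] /eqP->.
Qed.

(* [v] is the crossing of two grid lines (positive triangles), {v, a, a'} and
   {v, b, b'}. *)
Let cross v a a' b b' :=
  [/\ [/\ pos v a, pos v a', pos v b & pos v b'], pos a a', pos b b' &
      [/\ pos a b = false, pos a b' = false, pos a' b = false & pos a' b' = false]].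

Let cross_exists : 1 < #|W| -> exists v a a' b b', cross v a a' b b'.
Proof.
move=> W1; have [v vo] : exists v, v != o.
  have: 0 < #|[set~ o]| by rewrite cardsC1; case: #|W| W1 => [|[]].
  by case/card_gt0P=> v; rewrite !inE; exists v.
have /card_gt0P[a] : 0 < #|N v| by rewrite card_N.
rewrite inE => va; have [a' /andP[va' aa']] := third_exists va.
have /card_gt0P[b] : 0 < #|(N v :\ a) :\ a'|.
  have := cardsD1 a (N v); have := cardsD1 a' (N v :\ a); rewrite card_N //.
  by do 2!case: (_ \in _) => /=; lia.
rewrite !inE => /and3P[ba' ba vb].
have [b' /andP[vb' bb']] := third_exists vb.
have ab : pos a b = false.
  by apply: contraNF ba' => ab; apply/eqP/(third_unique va).
have a'b : pos a' b = false.
  apply: contraNF ba => ab'; apply/eqP/(third_unique va') => //; by rewrite posC.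
have b'a : a != b' by apply: contraTneq bb' => <-; rewrite posC ab.
have b'a' : a' != b' by apply: contraTneq bb' => <-; rewrite posC a'b.
exists v, a, a', b, b'; split=> //; split=> //.
  apply: contraNF ba => ab'; apply/eqP/(third_unique vb') => //.
    by rewrite posC.
  by rewrite posC.
apply: contraNF ba' => ab'; apply/eqP/(third_unique vb') => //; by rewrite posC.
Qed.

Let cross_swapl v a a' b b' : cross v a a' b b' -> cross v a' a b b'.
Proof. by case=> [[? ? ? ?] aa' ? [? ? ? ?]]; split; rewrite // posC. Qed.

Let cross_swapr v a a' b b' : cross v a a' b b' -> cross v a a' b' b.
Proof. by case=> [[? ? ? ?] aa' ? [? ? ? ?]]; split; rewrite // posC. Qed.

Let cross_flip v a a' b b' : cross v a a' b b' -> cross v b b' a a'.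
Proof.
by case=> [[? ? ? ?] aa' ? [? ? ? ?]]; split=> //; split; rewrite // posC.
Qed.

(** The grid cell that completes v, a, b to a rectangle; it exists because the non-adjacent a and b
    have exactly two common neighbours, one being v. *)
Let opposite v a b w := [/\ w != v, pos a w & pos b w].

Let opposite_exists v a a' b b' : cross v a a' b b' -> exists w, opposite v a b w.
Proof.
move=> [[va va' vb vb'] aa' bb' [ab ab' a'b a'b']]; apply: second_common => //.
by apply: contraTneq aa' => ->; rewrite posC a'b.
Qed.

Let oppositeP v a a' b b' w : cross v a a' b b' -> opposite v a b w ->
  [/\ pos v w = false, pos a' w = false & pos b' w = false].
Proof.
move=> [[va va' vb vb'] aa' bb' [ab ab' a'b a'b']] [wv aw bw].
split; apply/negP=> h.
- have e : a' = w by apply: (third_unique va).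
  by move: bw; rewrite -e posC a'b.
- by move/eqP: wv; apply; apply: (third_unique aa') => //; rewrite posC.
- by move/eqP: wv; apply; apply: (third_unique bb') => //; rewrite posC.
Qed.

(** Both w and w' lie on the second line through a. If the third point z of the line through a and w
    were not w', then v, a', w, w' and z would be five neighbours of a. *)
Let opposite_line v a a' b b' w w' : cross v a a' b b' ->
  opposite v a b w -> opposite v a b' w' -> pos w w'.
Proof.
move=> cr op op'; have [vw a'w _] := oppositeP cr op.
have [vw' a'w' bw'] := oppositeP (cross_swapr cr) op'.
move: cr op op' => [[va va' vb vb'] aa' bb' [_ _ a'b a'b']] [wv aw bw] [wv' aw' bw'b].
have [z /andP[az wz]] := third_exists aw.
have [<-//|zw'] := eqVneq z w'.
suff : pos a z = false by rewrite az.
apply: (N_exhausted (a := v) (b := a') (c := w) (d := w')); rewrite // 1?posC //.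
have [_ _ va'n] := pos_neq va'; have [_ _ zw] := pos_neq wz.
rewrite /= !inE !negb_or zw' va'n ![v == _]eq_sym wv wv' [z == w]eq_sym zw /=.
have -> : z != v by apply: contraTneq wz => ->; rewrite posC vw.
have -> : z != a' by apply: contraTneq wz => ->; rewrite posC a'w.
have -> : a' != w by apply: contraTneq bw => <-; rewrite posC a'b.
have -> : a' != w' by apply: contraTneq bw'b => <-; rewrite posC a'b'.
have -> // : w != w' by apply: contraTneq bw => ->; rewrite bw'.
Qed.

Let grid_exists : 1 < #|W| ->
  exists g : F9 -> W, [/\ injective g, forall p, g p != o &
    forall p q, p != q -> pos (g p) (g q) = aligned p q].
Proof.
move=> /cross_exists[v [a [a' [b [b' cr]]]]].
have [w11 o11] := opposite_exists cr.
have [w12 o12] := opposite_exists (cross_swapr cr).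
have [w21 o21] := opposite_exists (cross_swapl cr).
have [w22 o22] := opposite_exists (cross_swapl (cross_swapr cr)).
have flip x y w : opposite v x y w -> opposite v y x w by case.
have r1 := opposite_line cr o11 o12.
have r2 := opposite_line (cross_swapl cr) o21 o22.
have c1 := opposite_line (cross_flip cr) (flip _ _ _ o11) (flip _ _ _ o21).
have c2 := opposite_line (cross_flip (cross_swapr cr)) (flip _ _ _ o12) (flip _ _ _ o22).
have [f1 f2 f3] := oppositeP cr o11.
have [f4 f5 f6] := oppositeP (cross_swapr cr) o12.
have [f7 f8 f9] := oppositeP (cross_swapl cr) o21.
have [f10 f11 f12] := oppositeP (cross_swapl (cross_swapr cr)) o22.
move: cr o11 o12 o21 o22 => [[va va' vb vb'] aa' bb' [ab ab' a'b a'b']].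
move=> [_ g1 g2] [_ g3 g4] [_ g5 g6] [_ g7 g8].
(* The grid row by row: the first row and the first column are the two lines of the cross. *)
pose l := [:: v; b; b'; a; w11; w12; a'; w21; w22].
have posE x y c : pos x y = c -> pos y x = c by rewrite posC.
have l_uniq : uniq l.
  (* Adjacency to the five points of the cross already separates the nine cells. *)
  pose sig u := [:: pos a u; pos a' u; pos b u; pos b' u; pos v u].
  apply: (@map_uniq _ _ sig); rewrite /sig /= !posI.
  rewrite f1 f2 f3 f4 f5 f6 f7 f8 f9 f10 f11 f12 g1 g2 g3 g4 g5 g6 g7 g8.
  rewrite va va' vb vb' aa' bb' ab ab' a'b a'b'.
  rewrite (posE _ _ _ va) (posE _ _ _ va') (posE _ _ _ vb) (posE _ _ _ vb').
  rewrite (posE _ _ _ aa') (posE _ _ _ bb') (posE _ _ _ ab) (posE _ _ _ ab').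
  by rewrite (posE _ _ _ a'b) (posE _ _ _ a'b').
pose g (p : F9) := nth o l (3 * val p.1 + val p.2).
have lt3 (i : 'F_3) : val i < 3 by apply: ltn_ord i.
have lt9 (p : F9) : 3 * val p.1 + val p.2 < 9.
  exact: ternary_lt.
have g_inj : injective g.
  move=> [i j] [i' j'] /eqP; rewrite /g nth_uniq // => /eqP.
  by case/ternary_inj=> // e e'; congr (_, _); apply: val_inj.
have g_pos p q : p != q -> aligned p q -> pos (g p) (g q).
  case: p q => [[i hi] [j hj]] [[i' hi'] [j' hj']].
  case: i hi => [|[|[|//]]] hi; case: j hj => [|[|[|//]]] hj;
  case: i' hi' => [|[|[|//]]] hi'; case: j' hj' => [|[|[|//]]] hj' //= _ _;
  by [|rewrite posC].
have g_nbr p q : q \in grid_nbr p -> pos (g p) (g q).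
  by case/grid_nbr_aligned/andP; apply: g_pos.
exists g; split=> // [p|p q pq].
  have /g_nbr gp : (p.1 + 1, p.2)%R \in grid_nbr p by rewrite mem_head.
  by have [] := pos_neq gp.
case pq': (aligned p q); first exact: g_pos.
(* The four aligned cells exhaust the neighbours of [g p], so no other cell is adjacent to it. *)
have := grid_nbr_uniq pq (negbT pq'); rewrite -(map_inj_uniq g_inj).
by apply: N_exhausted; apply: g_nbr; rewrite !inE eqxx ?orbT.
Qed.

Hypothesis card10 : #|W| = 10.

Lemma conference_SP9p : exists f : W -> option F9,
  bijective f /\ forall x y, x != y -> n x y = SP9p_neg (f x) (f y).
Proof.
have [|g [g_inj go g_pos]] := grid_exists; first by rewrite card10.
(* The all-positive vertex o plays the part of the vertex added to SP_9; [h] is bijective by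
   counting. *)
pose h (u : option F9) := if u is Some p then g p else o.
have h_inj : injective h.
  case=> [p|] [q|] //=; first by move/g_inj->.
    by move/eqP; rewrite (negPf (go p)).
  by move/eqP; rewrite eq_sym (negPf (go q)).
have [|f hK fK] := inj_card_bij h_inj.
  by rewrite card10 card_option card_prod !card_ord.
exists f; split; first by exists h.
move=> x y; rewrite -(fK x) -(fK y) !hK (inj_eq h_inj).
case: (f x) (f y) => [p|] [q|] //= pq.
- have {}pq : p != q by apply: contraNneq pq => ->.
  have := g_pos _ _ pq; rewrite /pos !go (inj_eq g_inj) pq /= f9squareE.
  rewrite /f9sub /= !GRing.subr_eq0 [q.1 == _]eq_sym [q.2 == _]eq_sym -/(aligned p q).
  by move=> <-; rewrite negbK.
- by rewrite nC n_o.
- by rewrite n_o.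
Qed.

End NormalizedConference.

Theorem mainTheorem18 (adjH negH : rel 'I_10)
  (adjH_sym : symmetric adjH) (adjH_irr : irreflexive adjH)
  (negH_sym : symmetric negH) :
  (forall (V : finType) (adjG negG : rel V),
      symmetric adjG -> irreflexive adjG -> symmetric negG ->
      planar adjG -> signed_hom adjG negG adjH negH) ->
  exists (X : {set 'I_10}) (f : 'I_10 -> option F9),
    [/\ bijective f,
        forall x y, adjH x y = SP9p_adj (f x) (f y) &
        forall x y, adjH x y -> resign negH X x y = SP9p_neg (f x) (f y)].
Proof.
move=> univ.
have adj_all a b : a != b -> adjH a b /\ halved negH a b.
  apply: complete_and_halved; rewrite ?card_ord // => M.
  have pl := planar_triangulation (@edgeC M) (@edgeI M) (thirdP M).
  have [X [Y [f fP]]] := univ M _ _ (@edgeC M) (@edgeI M) (@sgnC M) pl.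
  exists f, (fun x => (x \in X) (+) (f x \in Y)) => x y /fP[adjf].
  rewrite /resign; case: (x \in X) (y \in X) (f x \in Y) (f y \in Y)
    (negH _ _) (sgn x y) => [] [] [] [] [] [] //.
(* Resigning the negative neighbours of o makes every edge at o positive. *)
pose o : 'I_10 := ord0; pose X := [set c | (c != o) && negH o c].
pose n := resign negH X.
have nC : symmetric n.
  by move=> x y; rewrite /n /resign negH_sym; congr (_ (+) _); apply: addbC.
have n_o c : c != o -> n o c = false.
  by move=> co; rewrite /n /resign !inE eqxx co /= addbb.
have n_halved a b : a != b -> halved n a b.
  by move=> ab t; rewrite sign_class_resign; have [_] := adj_all _ _ ab; apply.
have [f [f_bij fP]] := conference_SP9p nC n_o n_halved (card_ord 10).
exists X, f; split=> // [x y|x y xy].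
  have -> : SP9p_adj (f x) (f y) = (x != y).
    by rewrite -(inj_eq (bij_inj f_bij)); case: (f x) (f y) => [p|] [q|].
  by have [->|/adj_all[]] := eqVneq x y.
by apply: fP; apply: contraTneq xy => ->; rewrite adjH_irr.
Qed.
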